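(* Let $k$ be a field of characteristic $0$, let $m,n\ge 1$ be integers, and let $X_i=(x_{i1},\dots,x_{in})$, $1\le i\le m$, be arrays of variables $x_{ij}$, all independent over $k$. The field $k(X_1,\dots,X_m)_0^G$ is generated over $k$ by the element $$q_{1,\dots,1}:=\operatorname{tr}(X_1\cdots X_m)\,\operatorname{tr}\bigl((X_1\cdots X_m)^{-1}\bigr)$$ together with the elements $$\operatorname{tr}(X_i^r)\,\operatorname{tr}(X_i^{-r}),\qquad 1\le i\le m,\quad 1\le r\le \frac{n(n-1)}{2}.$$
   Context: $n$-tuples are operated on as if they were diagonal $n\times n$ matrices: products, inverses and integer powers are taken componentwise, and $\operatorname{tr}$ of an $n$-tuple is the sum of its entries. $k(X_1,\dots,X_m)_0$ is the subfield of $k(x_{11},x_{12},\dots,x_{mn})$ of rational functions homogeneous of degree $0$ in each array $X_i$ (the function field of $(\mathbb{P}^{n-1})^m$); equivalently, it is generated over $k$ by all ratios $x_{ij}/x_{il}$. The symmetric group $S_n$ acts on it by simultaneously permuting $x_{i1},\dots,x_{in}$ for each $i$ (the same permutation of the second index for all $i$); the group $T=\{1,\tau\}$ of order two acts by the $k$-automorphism $\tau(x_{ij})=x_{ij}^{-1}$ for all $i,j$. These actions commute, and $G:=S_n\times T$. *)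

(* Defs.v *)
From HB Require Import structures.
From mathcomp Require Import all_boot all_order all_algebra all_fingroup.
From mathcomp Require Import fraction.
From mathcomp Require Import mpoly.

Set Implicit Arguments.
Unset Strict Implicit.
Unset Printing Implicit Defensive.

Import GRing.Theory.
Local Open Scope ring_scope.

Lemma fracE (R : idomainType) (f : {fraction R}) :
  let r := generic_quotient.repr f in
  f = FracField.tofrac \n_r / FracField.tofrac \d_r.
Proof.
move=> r.
have r0 : FracField.tofrac \d_r != 0 by rewrite tofrac_eq0 denom_ratioP.
apply: (mulIf r0); rewrite divfK // -[f in LHS]generic_quotient.reprK -/r.
unlock FracField.tofrac; rewrite -[LHS]FracField.pi_mul; apply/eqP.
by rewrite FracField.equivf_def /FracField.mulf !numden_Ratio
  ?mulf_neq0 ?oner_eq0 ?denom_ratioP // !mulr1 mulrC.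
Qed.

(* k(x_11, ..., x_mn); the m * n variables are numbered by mxvec_index. *)
Definition ratfun (k : fieldType) (m n : nat) : fieldType :=
  {fraction {mpoly k[m * n]}}.

Section RationalFunctions.
Variables (k : fieldType) (m n : nat).
Local Notation R := {mpoly k[m * n]}.
Local Notation F := (ratfun k m n).

Definition rpoly (p : R) : F := FracField.tofrac p.

Fact rpoly_is_zmod_morphism : zmod_morphism rpoly.
Proof. exact: tofracB. Qed.
Fact rpoly_is_monoid_morphism : monoid_morphism rpoly.
Proof. by split; [apply: tofrac1 | apply: rmorphM]. Qed.
HB.instance Definition _ :=
  GRing.isZmodMorphism.Build R F rpoly rpoly_is_zmod_morphism.
HB.instance Definition _ :=
  GRing.isMonoidMorphism.Build R F rpoly rpoly_is_monoid_morphism.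

Lemma rpoly_inj : injective rpoly.
Proof. by move=> p q /eqP; rewrite tofrac_eq => /eqP. Qed.

Lemma rpoly_eq0 p : (rpoly p == 0) = (p == 0).
Proof. exact: tofrac_eq0. Qed.

Definition rcst (c : k) : F := rpoly c%:MP.
Definition rvar (i : 'I_m) (j : 'I_n) : F := rpoly 'X_(mxvec_index i j).

HB.instance Definition _ := GRing.RMorphism.copy rcst (rpoly \o @mpolyC (m * n) k).

Inductive genfield (S : F -> Prop) : F -> Prop :=
| gen_cst c : genfield S (rcst c)
| gen_mem f : S f -> genfield S f
| gen_add f g : genfield S f -> genfield S g -> genfield S (f + g)
| gen_opp f : genfield S f -> genfield S (- f)
| gen_mul f g : genfield S f -> genfield S g -> genfield S (f * g)
| gen_inv f : genfield S f -> genfield S f^-1.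

Definition adeg (i : 'I_m) (a : 'X_{1..m * n}) : nat :=
  (\sum_(j < n) a (mxvec_index i j))%N.

Fact adeg0 i : adeg i 0%MM = 0%N.
Proof. by rewrite /adeg big1 // => j _; rewrite mnm0E. Qed.

Fact adegD i : {morph adeg i : a b / (a + b)%MM >-> (a + b)%N}.
Proof.
by move=> a b; rewrite /adeg -big_split; apply: eq_bigr => j _; rewrite mnmDE.
Qed.

HB.instance Definition _ i :=
  isMeasure.Build (m * n)%N (adeg i) (adeg0 i) (adegD i).

(* k(X_1, ..., X_m)_0, as the function field of (P^(n-1))^m: the quotients of *)
(* two multihomogeneous polynomials of the same multidegree d.                *)
Definition homog0 (f : F) : Prop :=
  exists (p q : R) (d : 'I_m -> nat),
    [/\ q != 0, f = rpoly p / rpoly q &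
        forall i, p \is ishomog1 (d i) (adeg i) /\
                  q \is ishomog1 (d i) (adeg i)].

Definition psubst (v : 'M[F]_(m, n)) : R -> F :=
  mmap rcst (fun a => mxvec v 0 a).

Fact psubst_is_zmod_morphism v : zmod_morphism (psubst v).
Proof. exact: mmap_is_additive. Qed.
Fact psubst_is_monoid_morphism v : monoid_morphism (psubst v).
Proof.
by have [pM p1] := mmap_is_multiplicative (fun a => mxvec v 0 a) rcst; split.
Qed.
HB.instance Definition _ v :=
  GRing.isZmodMorphism.Build R F (psubst v) (psubst_is_zmod_morphism v).
HB.instance Definition _ v :=
  GRing.isMonoidMorphism.Build R F (psubst v) (psubst_is_monoid_morphism v).

(* Substitution of v i j for x_ij in a rational function: independent of the  *)
(* chosen quotient (see ratsubst_frac) only when the v i j are algebraically  *)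
(* independent over k, as they are in symact and tau.                         *)
Definition ratsubst (v : 'M[F]_(m, n)) (f : F) : F :=
  let r := generic_quotient.repr (f : {fraction R}) in
  psubst v \n_r / psubst v \d_r.

Definition alg_indep (v : 'M[F]_(m, n)) : Prop :=
  forall p : R, psubst v p = 0 -> p = 0.

Definition symact (s : 'S_n) : F -> F :=
  ratsubst (\matrix_(i, j) rvar i (s j)).

Definition tau : F -> F := ratsubst (\matrix_(i, j) (rvar i j)^-1).

Lemma psubstC v c : psubst v c%:MP = rcst c.
Proof. exact: mmapC. Qed.

Lemma psubstX v i j : psubst v 'X_(mxvec_index i j) = v i j.
Proof. by rewrite /psubst mmapX mmap1U mxvecE. Qed.

Lemma ratfunE (f : F) :
  let r := generic_quotient.repr (f : {fraction R}) in
  f = rpoly \n_r / rpoly \d_r.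
Proof. exact: fracE. Qed.

Lemma ratfunP (f : F) : exists p q : R, q != 0 /\ f = rpoly p / rpoly q.
Proof.
pose r := generic_quotient.repr (f : {fraction R}); exists \n_r, \d_r.
by split; [apply: denom_ratioP | apply: ratfunE].
Qed.

Section IndepSubst.
Variables (v : 'M[F]_(m, n)) (v_indep : alg_indep v).

Lemma psubst_neq0 p : p != 0 -> psubst v p != 0.
Proof. by apply: contra_neq => /v_indep. Qed.

Lemma ratsubst_frac (p q : R) : q != 0 ->
  ratsubst v (rpoly p / rpoly q) = psubst v p / psubst v q.
Proof.
move=> q0; rewrite /ratsubst; set f := rpoly p / rpoly q.
have /= := ratfunE f; set r := generic_quotient.repr (f : {fraction R}).
set a := \n_r; set b := \d_r => Ef.
have b0 : b != 0 by apply: denom_ratioP.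
apply/eqP; rewrite eqr_div ?psubst_neq0 // -!rmorphM; apply/eqP.
congr (psubst v _); apply: rpoly_inj; apply/eqP.
by rewrite !rmorphM /= -eqr_div ?rpoly_eq0 // -Ef.
Qed.

Lemma ratsubst_rpoly (p : R) : ratsubst v (rpoly p) = psubst v p.
Proof.
by rewrite -[rpoly p]divr1 -(rmorph1 rpoly) ratsubst_frac ?oner_eq0 // rmorph1 divr1.
Qed.

Lemma ratsubst_is_zmod_morphism : zmod_morphism (ratsubst v).
Proof.
move=> f g; have [a [b [b0 ->]]] := ratfunP f; have [c [d [d0 ->]]] := ratfunP g.
rewrite -mulNr addf_div ?tofrac_eq0 // -rmorphN -!rmorphM -rmorphD.
rewrite !ratsubst_frac ?mulf_neq0 // -mulNr addf_div ?psubst_neq0 //.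
by rewrite -rmorphN -!rmorphM -rmorphD.
Qed.

Lemma ratsubst_is_monoid_morphism : monoid_morphism (ratsubst v).
Proof.
split=> [|f g]; first by rewrite -[1 in LHS](rmorph1 rpoly) ratsubst_rpoly rmorph1.
have [a [b [b0 ->]]] := ratfunP f; have [c [d [d0 ->]]] := ratfunP g.
rewrite mulf_div -!rmorphM !ratsubst_frac ?mulf_neq0 // mulf_div.
by rewrite -!rmorphM.
Qed.

Lemma ratsubst_cst c : ratsubst v (rcst c) = rcst c.
Proof. by rewrite ratsubst_rpoly psubstC. Qed.

Lemma ratsubst_var i j : ratsubst v (rvar i j) = v i j.
Proof. by rewrite ratsubst_rpoly psubstX. Qed.

End IndepSubst.

Lemma psubst_sum v (p : R) :
  psubst v p = \sum_(a <- msupp p)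
    rcst p@_a * \prod_i \prod_j v i j ^+ a (mxvec_index i j).
Proof.
rewrite /psubst /mmap; apply: eq_bigr => a _; congr (_ * _).
rewrite /mmap1 (reindex _ (curry_mxvec_bij _ _)) /= pair_bigA /=.
by apply: eq_bigr => -[i j] _; rewrite mxvecE.
Qed.

Lemma rpoly_mnm (a : 'X_{1..m * n}) :
  rpoly 'X_[a] = \prod_i \prod_j rvar i j ^+ a (mxvec_index i j).
Proof.
rewrite mpolyXE_id rmorph_prod /= (reindex _ (curry_mxvec_bij _ _)) /=.
by rewrite pair_bigA; apply: eq_bigr => -[i j] _; rewrite rmorphXn.
Qed.

Lemma rvar_neq0 i j : rvar i j != 0.
Proof. by rewrite rpoly_eq0 -msize_poly_eq0 msizeX. Qed.

Lemma sym_indep (s : 'S_n) : alg_indep (\matrix_(i, j) rvar i (s j)).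
Proof.
pose w (t : 'S_n) : (m * n).-tuple R :=
  [tuple mxvec (\matrix_(i, j) 'X_(mxvec_index i (t j))) 0 a | a < m * n].
have wE p : psubst (\matrix_(i, j) rvar i (s j)) p = rpoly (p \mPo w s).
  rewrite psubst_sum comp_mpolyE raddf_sum /=; apply: eq_bigr => a _.
  rewrite -mul_mpolyC rmorphM; congr (_ * _).
  rewrite rmorph_prod /= (reindex _ (curry_mxvec_bij _ _)) /= pair_bigA.
  by apply: eq_bigr => -[i j] _; rewrite rmorphXn tnth_mktuple mxvecE !mxE.
have wK p : (p \mPo w s) \mPo w s^-1%g = p.
  rewrite -[RHS]comp_mpoly_id [p \mPo w s]comp_mpolyE [RHS]comp_mpolyE raddf_sum.
  apply: eq_bigr => a _; rewrite /= comp_mpolyZ; congr (_ *: _).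
  rewrite rmorph_prod /=; apply: eq_bigr => b _; rewrite rmorphXn /=.
  congr (_ ^+ _); rewrite !tnth_mktuple; case/mxvec_indexP: b => i j.
  by rewrite mxvecE mxE comp_mpolyXU -tnth_nth tnth_mktuple mxvecE mxE permK.
by move=> p /eqP; rewrite wE rpoly_eq0 => /eqP p0; rewrite -[p]wK p0 comp_mpoly0.
Qed.

Lemma tau_indep : alg_indep (\matrix_(i, j) (rvar i j)^-1).
Proof.
move=> p p0.
pose N : 'X_{1..m * n} := [multinom msize p | a < m * n].
have leN a : a \in msupp p -> (a <= N)%MM.
  move=> /msize_mdeg_lt lta; apply/mnm_lepP => b; rewrite mnmE.
  by apply: leq_trans (ltnW lta); rewrite mdegE (bigD1 b) //= leq_addr.
pose q : R := \sum_(a <- msupp p) p@_a *: 'X_[N - a].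
have q0 : q = 0.
  apply/eqP; rewrite -rpoly_eq0; apply/eqP.
  transitivity (rpoly 'X_[N] * psubst (\matrix_(i, j) (rvar i j)^-1) p);
    last by rewrite p0 mulr0.
  rewrite psubst_sum mulr_sumr raddf_sum /= big_seq [RHS]big_seq.
  apply: eq_bigr => a a_p.
  rewrite -mul_mpolyC rmorphM /= mulrCA; congr (_ * _).
  rewrite !rpoly_mnm -big_split /=; apply: eq_bigr => i _.
  rewrite -big_split /=; apply: eq_bigr => j _ /=.
  have /mnm_lepP/(_ (mxvec_index i j)) leab := leN a a_p.
  rewrite mnmBE mxE exprVn; set u := N _ in leab *.
  by rewrite expfB_cond // (negPf (rvar_neq0 _ _)).
apply/mpolyP => a; rewrite mcoeff0.
have [a_p|/memN_msupp_eq0 //] := boolP (a \in msupp p).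
have : q@_(N - a) = 0 by rewrite q0 mcoeff0.
rewrite /q raddf_sum /= (bigD1_seq a) //= mcoeffZ mcoeffX eqxx mulr1.
rewrite big_seq_cond big1 ?addr0 // => b /andP[b_p ba].
rewrite mcoeffZ mcoeffX; case: eqP => [E|]; last by rewrite mulr0.
case/eqP: ba; apply/mnmP => c; have /mnmP/(_ c) := E; rewrite !mnmBE.
have /mnm_lepP/(_ c) lea := leN a a_p; have /mnm_lepP/(_ c) leb := leN b b_p.
by move=> E'; rewrite -(subKn leb) E' subKn.
Qed.

HB.instance Definition _ s := GRing.isZmodMorphism.Build F F (symact s)
  (ratsubst_is_zmod_morphism (@sym_indep s)).
HB.instance Definition _ s := GRing.isMonoidMorphism.Build F F (symact s)
  (ratsubst_is_monoid_morphism (@sym_indep s)).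
HB.instance Definition _ := GRing.isZmodMorphism.Build F F tau
  (ratsubst_is_zmod_morphism tau_indep).
HB.instance Definition _ := GRing.isMonoidMorphism.Build F F tau
  (ratsubst_is_monoid_morphism tau_indep).

Lemma symact_cst s c : symact s (rcst c) = rcst c.
Proof. exact: ratsubst_cst (@sym_indep s) c. Qed.
Lemma symact_var s i j : symact s (rvar i j) = rvar i (s j).
Proof. by rewrite /symact (ratsubst_var (@sym_indep s)) mxE. Qed.
Lemma tau_cst c : tau (rcst c) = rcst c.
Proof. exact: ratsubst_cst tau_indep c. Qed.
Lemma tau_var i j : tau (rvar i j) = (rvar i j)^-1.
Proof. by rewrite /tau (ratsubst_var tau_indep) mxE. Qed.

Lemma ratfun_morph_eq (phi psi : {rmorphism F -> F}) :
    (forall c, phi (rcst c) = psi (rcst c)) ->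
    (forall i j, phi (rvar i j) = psi (rvar i j)) ->
  phi =1 psi.
Proof.
move=> Ec Ev f.
have Ep (p : R) : phi (rpoly p) = psi (rpoly p).
  rewrite [p]mpolyE !raddf_sum /=; apply: eq_bigr => a _.
  rewrite -mul_mpolyC !rmorphM /= rpoly_mnm; congr (_ * _).
    exact: Ec.
  rewrite !rmorph_prod; apply: eq_bigr => i _.
  by rewrite !rmorph_prod; apply: eq_bigr => j _; rewrite !rmorphXn /= Ev.
by have [p [q [_ ->]]] := ratfunP f; rewrite !fmorph_div /= !Ep.
Qed.

Lemma symact1 : symact 1%g =1 id.
Proof.
apply: (@ratfun_morph_eq (symact 1%g) idfun) => [c|i j] /=.
  exact: symact_cst.
by rewrite symact_var perm1.
Qed.

Lemma symactM s t f : symact (s * t)%g f = symact t (symact s f).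
Proof.
apply: (@ratfun_morph_eq (symact (s * t)%g) (symact t \o symact s)) => [c|i j].
  by rewrite /= !symact_cst.
by rewrite /= !symact_var permM.
Qed.

Lemma tauK : involutive tau.
Proof.
apply: (@ratfun_morph_eq (tau \o tau) idfun) => [c|i j] /=.
  by rewrite !tau_cst.
by rewrite tau_var fmorphV /= tau_var invrK.
Qed.

Lemma symact_tau s f : symact s (tau f) = tau (symact s f).
Proof.
apply: (@ratfun_morph_eq (symact s \o tau) (tau \o symact s)) => [c|i j] /=.
  by rewrite !(tau_cst, symact_cst).
by rewrite tau_var fmorphV /= !symact_var tau_var.
Qed.

(* G = S_n x T, with T written additively: the second component is the        *)
(* exponent of tau. Permutations compose left to right, so the action of S_n  *)
(* by x_ij |-> x_i(s j) is a right action.                                    *)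
Definition Gact_fun (f : F) (g : 'S_n * 'Z_2) : F :=
  iter g.2 tau (symact g.1 f).

Fact Gact_fun1 : Gact_fun^~ 1%g =1 id.
Proof. by move=> f; rewrite /Gact_fun /= symact1. Qed.

Fact Gact_funM f : act_morph Gact_fun f.
Proof.
move=> [s a] [t b]; rewrite /Gact_fun /=.
have symact_iter c h : symact t (iter c tau h) = iter c tau (symact t h).
  by elim: c => //= c IHc; rewrite symact_tau IHc.
have iter_odd c h : iter c tau h = if odd c then tau h else h.
  by elim: c => //= c ->; case: (odd c) => //=; rewrite tauK.
rewrite symact_iter -symactM -iterD 2!iter_odd.
congr (if _ then _ else _).
by case: a b => [[|[|?]] //= ?] [[|[|?]] //= ?].
Qed.

Definition Gact : {action ('S_n * 'Z_2)%type &-> F} :=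
  TotalAction Gact_fun1 Gact_funM.

Definition ttr (v : 'I_n -> F) : F := \sum_j v j.

Definition qones : F :=
  ttr (fun j => \prod_i rvar i j) * ttr (fun j => (\prod_i rvar i j)^-1).

Definition qpow (i : 'I_m) (r : nat) : F :=
  ttr (fun j => rvar i j ^+ r) * ttr (fun j => rvar i j ^- r).

Definition gens (f : F) : Prop :=
  f = qones \/
  exists (i : 'I_m) (r : nat), (1 <= r <= (n * (n - 1)) %/ 2)%N /\ f = qpow i r.

End RationalFunctions.

Arguments rpoly {k m n} p.
Arguments rcst {k} m n c.
Arguments rvar {k m n} i j.
Arguments symact {k m n} s f.
Arguments tau {k m n} f.
Arguments qones {k m n}.
Arguments qpow {k m n} i r.
Arguments gens {k m n} f.

(* Main.v *)
Require Import Defs.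
From HB Require Import structures.
From mathcomp Require Import all_boot all_order all_algebra all_fingroup.
From mathcomp Require Import fraction.
From mathcomp Require Import mpoly.
From mathcomp Require Import ring.
From Stdlib Require Import ClassicalEpsilon.

Set Implicit Arguments.
Unset Strict Implicit.
Unset Printing Implicit Defensive.

Import GRing.Theory.
Local Open Scope ring_scope.

(** Let L be the field generated by the proposed generators. That L consists of
G-invariant functions, homogeneous of degree 0 in each array, is a direct
verification ([Gaut_genfield], [homog0_genfield]). For the converse, write
[xratio i j l] for x_ij / x_il and argue as in Galois theory.

- The sum over all j, l of the r-th powers of x_ij / x_il is
  tr(X_i^r) tr(X_i^-r). So L contains the power sums, up to half their number,
  of the n(n-1) ratios with j <> l. By Newton's identities it contains the first
  half of their elementary symmetric functions; as the family of ratios is stable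
  under inversion and has product 1, its polynomial is reciprocal, and the other
  half follows ([reciprocal_polyOver], [block_polyOver]). Hence the ratios are
  the roots of a separable polynomial over L, and every homogeneous function of
  degree 0 is a quotient of polynomials in them ([homog0_psubst]).

- A permutation of the ratios that preserves all their algebraic relations over
  L comes from a single element of G ([root_val_conjugate]). It preserves each
  array, since it preserves the polynomial of the array. The relations
  (x_ij / x_il)(x_il / x_ip) = x_ij / x_ip make it act on each array as an
  automorphism of the root system A_(n-1), that is, as a permutation of the
  indices composed, possibly, with inversion ([root_cocycle]). It also fixes the
  sum over j, l of the products over i of x_ij / x_il, which is q_(1,...,1);
  comparing monomials shows that all arrays undergo the same transformation
  ([eq_sum_prod_ratio]).

- A rational function of the ratios that is unchanged by all relation-preserving
  permutations lies in L. This is the fundamental theorem of Galois theory for a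
  splitting field; [relation_descent] proves it directly, with a Lagrange
  resolvent and the minimal polynomial of a primitive element, so that neither a
  finite-dimensional extension nor its automorphisms have to be constructed. *)

(** * Galois descent through algebraic relations *)

Section Descent.
Variables (L F : fieldType) (phi : {rmorphism L -> F}).
Variables (N : nat) (rho : 'I_N -> F).
Local Notation A := {mpoly L[N]}.
Local Notation "h .@{ v }" := (mmap phi v h) (at level 2, format "h .@{ v }").
Local Notation "p ^phi" := (map_poly phi p) (at level 2, format "p ^phi").

Lemma mmap_msym (v : 'I_N -> F) (s : 'S_N) (h : A) :
  (msym s h).@{v} = h.@{v \o s}.
Proof.
rewrite /msym {2}/mmap raddf_sum; apply: eq_bigr => a _ /=.
rewrite rmorphM /= mmapC; congr (_ * _).
by rewrite /mmap1 rmorph_prod; apply: eq_bigr => i _; rewrite rmorphXn /= mmapX mmap1U.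
Qed.

Section Symmetric.
Hypothesis rho_coef : exists P : {poly L}, P^phi = \prod_a ('X - (rho a)%:P).

(** By the fundamental theorem, a symmetric polynomial is a polynomial in the
elementary ones, whose values at the roots are, up to sign, coefficients of P. *)
Lemma symmetric_value (h : A) : h \is symmetric -> exists c, h.@{rho} = phi c.
Proof.
have [P Pm] := rho_coef.
have esym (i : 'I_N) : (mesym N L i.+1).@{rho} = phi ((-1) ^+ i.+1 * P`_(N - i.+1)).
  rewrite rmorphM rmorphXn rmorphN1 -coef_map Pm.
  have := mroots_coeff [tuple rho a | a < N] (inord i.+1).
  rewrite inordK ?ltnS //.
  have -> : \prod_(c <- [tuple rho a | a < N]) ('X - c%:P) = \prod_a ('X - (rho a)%:P).
    by rewrite big_tuple; apply: eq_bigr => a _; rewrite tnth_mktuple.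
  move=> ->; rewrite mulrA -exprMn mulrNN mulr1 expr1n mul1r.
  rewrite /mesym !raddf_sum /=; apply: eq_bigr => S _.
  rewrite !rmorph_prod; apply: eq_bigr => a _.
  by rewrite /= mmapX mmap1U mevalXU tnth_mktuple.
case/sym_fundamental => t [<- _].
exists (t.@[fun i : 'I_N => (-1) ^+ i.+1 * P`_(N - i.+1)]).
rewrite comp_mpolyE mevalE !raddf_sum /=; apply: eq_bigr => a _.
rewrite -mul_mpolyC !rmorphM /= mmapC; congr (_ * _).
rewrite !rmorph_prod; apply: eq_bigr => i _.
by rewrite !rmorphXn /= tnth_mktuple esym.
Qed.

Lemma symmetric_poly (p : {poly A}) : (forall s, map_poly (msym s) p = p) ->
  exists q : {poly L}, q^phi = map_poly (mmap phi rho) p.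
Proof.
move=> sym_p.
have/fin_all_exists [c cE] (i : 'I_(size p)) : exists c, (p`_i).@{rho} = phi c.
  by apply: symmetric_value; apply/issymP => s; rewrite -coef_map sym_p.
exists (\poly_(i < size p) oapp c 0 (insub i)); apply/polyP => i.
rewrite !coef_map coef_poly /=; case: ltnP => lti; last first.
  by rewrite nth_default // !rmorph0.
by rewrite insubT /= -cE.
Qed.

Section Resolvent.
Variable Theta : A.
Local Notation theta s := (Theta.@{rho \o s}).

(** The Lagrange interpolation numerator for the values [h.@{rho \o s}] at the
points [theta s]. It is formed over the polynomial ring in the roots, where the
symmetric group visibly fixes it, so that its value has coefficients in L. *)
Definition resolvent_gen (h : A) : {poly A} :=
  \sum_(s : 'S_N) (msym s h)%:P *
    \prod_(t : 'S_N | t != s) ('X - (msym t Theta)%:P).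

Lemma resolvent_gen_sym h s : map_poly (msym s) (resolvent_gen h) = resolvent_gen h.
Proof.
rewrite [RHS](reindex_inj (mulIg s)) raddf_sum; apply: eq_bigr => t _ /=.
rewrite rmorphM /= map_polyC /= -msymMm; congr (_ * _).
rewrite rmorph_prod /= [RHS](reindex_inj (mulIg s)) /=.
apply: eq_big => [u|u _]; first by rewrite (inj_eq (mulIg s)).
by rewrite rmorphB /= map_polyX map_polyC /= -msymMm.
Qed.

Lemma resolvent_ex h : exists q : {poly L},
  q^phi = \sum_(s : 'S_N) (h.@{rho \o s})%:P *
    \prod_(t : 'S_N | t != s) ('X - (theta t)%:P).
Proof.
have [q qE] := symmetric_poly (resolvent_gen_sym h).
exists q; rewrite qE raddf_sum; apply: eq_bigr => s _ /=.
rewrite rmorphM /= map_polyC /= mmap_msym; congr (_ * _).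
rewrite rmorph_prod; apply: eq_bigr => t _.
by rewrite rmorphB /= map_polyX map_polyC /= mmap_msym.
Qed.

Lemma resolvent_prod : exists q : {poly L},
  q^phi = \prod_(s : 'S_N) ('X - (theta s)%:P).
Proof.
have [s|q qE] := @symmetric_poly (\prod_(s : 'S_N) ('X - (msym s Theta)%:P)).
  rewrite rmorph_prod /= [RHS](reindex_inj (mulIg s)); apply: eq_bigr => t _.
  by rewrite rmorphB /= map_polyX map_polyC /= -msymMm.
exists q; rewrite qE rmorph_prod; apply: eq_bigr => s _.
by rewrite rmorphB /= map_polyX map_polyC /= mmap_msym.
Qed.
End Resolvent.
End Symmetric.

(** The minimal polynomial of x over L. It need not be computable, so it is
reached by descent: a polynomial vanishing at x that is not a multiple of q
leaves a smaller one, its remainder modulo q. *)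
Lemma minpoly_ex (x : F) (q : {poly L}) : q != 0 -> root q^phi x ->
  exists2 M : {poly L}, M != 0 & forall p : {poly L}, root p^phi x = (M %| p).
Proof.
have [d] := ubnP (size q); elim: d q => // d IHd q /ltnSE-le_q q0 qx.
have [[p [ndvd px]]|minq] :=
    classic (exists p : {poly L}, ~~ (q %| p) /\ root p^phi x); last first.
  exists q => // p; apply/idP/idP => [px|].
    by apply/negPn/negP => ndvd; apply: minq; exists p.
  case/dvdpP => r ->; rewrite rmorphM rootM qx orbT //.
have := IHd (p %% q); apply.
- by apply: leq_trans le_q; rewrite ltn_modp.
- by [].
- rewrite map_modp; apply/eqP; move: (divp_eq p^phi q^phi) px => pE.
  rewrite {1}pE rootE hornerD hornerM (rootP qx) mulr0 add0r => /eqP //.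
Qed.

(** The sums are the values at T = t of polynomials in T with coefficients
[rho (s a)]. As rho is injective, these polynomials are pairwise distinct, and in
characteristic 0 some natural number avoids all the roots of their differences. *)
Lemma separating_weights : injective rho -> [pchar F] =i pred0 ->
  exists t : nat, injective (fun s : 'S_N => \sum_(a < N) t%:R ^+ a * rho (s a)).
Proof.
move=> rho_inj char0.
pose P (s t : 'S_N) := \sum_(a < N) (rho (s a) - rho (t a)) *: 'X^a.
have P0 s t : s != t -> P s t != 0.
  apply: contra_neq => Pst; apply/permP => a; apply: rho_inj; apply/eqP.
  rewrite -subr_eq0; apply/eqP; transitivity (P s t)`_a; last by rewrite Pst coef0.
  rewrite coef_sum (bigD1 a) //= coefZ coefXn eqxx mulr1 big1 ?addr0 // => b ba.
  by rewrite coefZ coefXn eq_sym val_eqE (negPf ba) mulr0.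
pose Q := \prod_(u : 'S_N * 'S_N | u.1 != u.2) P u.1 u.2.
have Q0 : Q != 0 by apply/prodf_neq0 => u; apply: P0.
have natI : injective (fun n : nat => n%:R : F).
  have /pcharf0P nat0 := char0; move=> i j; wlog le_ij : i j / (i <= j)%N => [IH ij|ij].
    by case/orP: (leq_total i j) => le; [|apply/esym]; apply: IH.
  apply/eqP; rewrite eqn_leq le_ij /= -subn_eq0 -nat0.
  by rewrite natrB // ij subrr.
have : ~~ all (root Q) [seq n%:R | n <- iota 0 (size Q)].
  apply/negP => /(max_poly_roots Q0); rewrite map_inj_uniq ?iota_uniq //.
  by rewrite size_map size_iota ltnn => /(_ isT).
case/allPn => _ /mapP[n _ ->] nroot; exists n => s t /eqP; rewrite -subr_eq0 => /eqP st.
apply/eqP; apply: contraNT nroot => ne_st; rewrite /Q (bigD1 (s, t)) //= rootM.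
apply/orP; left; apply/eqP; rewrite -[RHS]st horner_sum -sumrB; apply: eq_bigr => a _.
by rewrite hornerZ hornerXn -mulrBr mulrC.
Qed.

(** Let [theta s] be the conjugates of a primitive element, H h the interpolation
polynomial of h, and M the minimal polynomial of [theta 1]. If [r.@{rho} = 0],
then H r vanishes at [theta 1], so M divides it; hence every s whose [theta s] is
a root of M preserves all relations. The hypothesis now says that H h1 and
f * H h2 agree at all the roots of M, which are simple, so their remainders
modulo M are equal, and f is a ratio of coefficients of two polynomials over L. *)
Theorem relation_descent (h1 h2 : A) (f : F) :
    [pchar F] =i pred0 -> injective rho ->
    (exists P : {poly L}, P^phi = \prod_a ('X - (rho a)%:P)) ->
    h2.@{rho} != 0 ->
    (forall s : 'S_N, (forall r : A, r.@{rho} = 0 -> r.@{rho \o s} = 0) ->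
       h1.@{rho \o s} = f * h2.@{rho \o s}) ->
  exists c, f = phi c.
Proof.
move=> char0 rho_inj rho_coef h2_neq0 hf.
have [t t_inj] := separating_weights rho_inj char0.
pose Theta : A := \sum_(a < N) t%:R ^+ a *: 'X_a.
pose theta (s : 'S_N) := Theta.@{rho \o s}.
have theta_inj : injective theta.
  suff thE s : theta s = \sum_(a < N) t%:R ^+ a * rho (s a).
    by move=> s u; rewrite !thE => /t_inj.
  rewrite /theta /Theta raddf_sum; apply: eq_bigr => a _ /=.
  rewrite -mul_mpolyC rmorphM /= mmapC mmapX mmap1U. congr (_ * _).
  transitivity ((phi t%:R) ^+ a); [exact: rmorphXn | by rewrite rmorph_nat].
pose wt s := \prod_(u : 'S_N | u != s) (theta s - theta u).
have wt_neq0 s : wt s != 0.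
  by apply/prodf_neq0 => u ne_us; rewrite subr_eq0 (inj_eq theta_inj) eq_sym.
have /fin_all_exists [H HE] (b : bool) :=
  resolvent_ex rho_coef Theta (if b then h1 else h2).
have Hval h (q : {poly L}) :
    q^phi = \sum_(s : 'S_N) (h.@{rho \o s})%:P *
      \prod_(u : 'S_N | u != s) ('X - (theta u)%:P) ->
    forall s, q^phi.[theta s] = h.@{rho \o s} * wt s.
  move=> -> s; rewrite horner_sum (bigD1 s) //= [X in _ + X]big1 => [|u us].
    rewrite addr0 hornerM hornerC; congr (_ * _).
    by rewrite horner_prod; apply: eq_bigr => u _; rewrite !hornerE.
  by rewrite (bigD1 s) 1?eq_sym //= !hornerM hornerXsubC subrr !(mul0r, mulr0).
have Hb b := Hval _ _ (HE b).
have [R RE] := resolvent_prod rho_coef Theta.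
have mmap_id h : h.@{rho \o (1%g : 'S_N)} = h.@{rho} by rewrite -mmap_msym msym1m.
have R0 : R != 0.
  rewrite -(map_poly_eq0 phi) RE; apply/prodf_neq0 => s _; by rewrite polyXsubC_eq0.
have [|M M0 Mmin] := @minpoly_ex (theta 1%g) R R0.
  by rewrite RE (bigD1 1%g) //= rootM root_XsubC eqxx.
have M_conj s : root M^phi (theta s) -> h1.@{rho \o s} = f * h2.@{rho \o s}.
  move=> Ms; apply: hf => r r0.
  have [q qE] := resolvent_ex rho_coef Theta r.
  have qv := Hval _ _ qE.
  have : M %| q by rewrite -Mmin rootE qv mmap_id r0 mul0r.
  move/dvdpP => [v qv']; have := qv s; rewrite qv' rmorphM hornerM (rootP Ms) mulr0.
  by move/esym/eqP; rewrite mulf_eq0 (negPf (wt_neq0 s)) orbF => /eqP.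
have [rs [rsE rs_sub rs_uniq]] : exists rs : seq F, [/\ size M = (size rs).+1,
    forall x, x \in rs -> exists2 s, x = theta s & root M^phi x & uniq rs].
  have : M^phi %| R^phi.
    by rewrite dvdp_map -Mmin RE (bigD1 1%g) //= rootM root_XsubC eqxx.
  rewrite RE; case/dvdp_prod_XsubC => msk eqM.
  exists [seq theta s | s <- mask msk (index_enum {perm 'I_N})]; split.
  - by rewrite -(size_map_poly phi) (eqp_size eqM) size_prod_XsubC size_map.
  - move=> x /mapP[s s_in ->]; exists s => //.
    rewrite (eqp_root eqM) -(big_map theta predT (fun y => 'X - y%:P)).
    by rewrite root_prod_XsubC map_f.
  - by rewrite map_inj_uniq // mask_uniq // index_enum_uniq.
pose W b := (H b %% M)^phi.
have Wv b x : root M^phi x -> (W b).[x] = (H b)^phi.[x].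
  move=> Mx; rewrite [in RHS](divp_eq (H b) M) rmorphD rmorphM /=.
  by rewrite hornerD hornerM (rootP Mx) mulr0 add0r.
have W_eq : W true = f *: W false.
  apply/eqP; rewrite -subr_eq0; apply/eqP.
  apply: (@roots_geq_poly_eq0 _ _ rs) => //.
    apply/allP => x xrs; have [s xs Mx] := rs_sub x xrs.
    rewrite rootE hornerD hornerN hornerZ !Wv // xs !Hb /= M_conj -?xs //.
    by rewrite mulrA subrr.
  rewrite -ltnS -rsE -scaleNr.
  apply: leq_ltn_trans (size_polyD _ _) _.
  rewrite gtn_max (leq_ltn_trans (size_scale_leq _ _)) ?andbT !size_map_poly ?ltn_modp //.
have W2 : H false %% M != 0.
  apply: contraNneq (mulf_neq0 h2_neq0 (wt_neq0 1%g)) => W0.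
  rewrite -mmap_id -(Hb false) -Wv ?/W ?W0 ?rmorph0 ?horner0 //.
  by rewrite Mmin dvdpp.
exists ((H true %% M)`_(size (H false %% M)).-1 / lead_coef (H false %% M)).
rewrite fmorph_div -coef_map -/(W _) W_eq coefZ coef_map mulfK //.
by rewrite fmorph_eq0 lead_coef_eq0.
Qed.
End Descent.

(** * Newton identities and reciprocal polynomials *)

Section PowerSums.
Variables (F : fieldType) (S : divringClosed F).

(** The reversal of the polynomial with roots s: its k-th coefficient is, up to
sign, the k-th elementary symmetric function of s, whatever the size of s. *)
Definition rev_roots_poly (s : seq F) : {poly F} := \prod_(x <- s) (1 - x%:P * 'X).

(** The logarithmic derivative of the product of the 1 - x T is minus the sum of
the x / (1 - x T), and x / (1 - x T) is here truncated at order K. *)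
Lemma newton_logderiv (s : seq F) K : exists Q : {poly F},
  (\sum_(x <- s) x%:P * \sum_(i < K) (x%:P * 'X) ^+ i) * rev_roots_poly s
  = - (rev_roots_poly s)^`() + 'X^K * Q.
Proof.
rewrite /rev_roots_poly; elim: s => [|x s [Q IHs]].
  by exists 0; rewrite !big_nil mulr0 mul0r derivC oppr0 addr0.
rewrite !big_cons; set E := \prod_(y <- s) _ in IHs *.
set P := \sum_(y <- s) _ in IHs *; set g := \sum_(i < K) _.
have gE : (1 - x%:P * 'X) * g = 1 - x%:P ^+ K * 'X^K.
  by rewrite -exprMn; apply: oppr_inj; rewrite -mulNr !opprB subrX1.
exists ((1 - x%:P * 'X) * Q - x%:P ^+ K.+1 * E).
have -> : ((1 - x%:P * 'X) * E)^`() = - x%:P * E + (1 - x%:P * 'X) * E^`().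
  by rewrite derivM derivB -[1 in LHS]polyC1 !derivE mulr1 sub0r.
move: (_^`()) gE IHs => E'; clearbody g P E => gE IHs.
transitivity (x%:P * ((1 - x%:P * 'X) * g) * E + (1 - x%:P * 'X) * (P * E)).
  by ring.
by rewrite gE IHs exprS; ring.
Qed.

Lemma newton_identity (s : seq F) k :
  \sum_(i < k.+1) (\sum_(x <- s) x ^+ i.+1) * (rev_roots_poly s)`_(k - i)
  = - ((rev_roots_poly s)`_k.+1 *+ k.+1).
Proof.
have [Q /(congr1 (fun p : {poly F} => p`_k))] := newton_logderiv s k.+1.
rewrite coefD coefXnM ltnSn addr0 coefN coef_deriv coefM => <-.
apply: eq_bigr => i _; congr (_ * _).
rewrite coef_sum; apply: eq_bigr => x _.
rewrite coefCM coef_sum (bigD1 i) //= big1 ?addr0 => [|j ne_ji].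
  by rewrite exprMn -rmorphXn coefCM coefXn eqxx mulr1 exprS.
by rewrite exprMn -rmorphXn coefCM coefXn eq_sym val_eqE (negPf ne_ji) mulr0.
Qed.

Lemma rev_roots_poly_mem (s : seq F) h : [pchar F] =i pred0 ->
    (forall r, (0 < r <= h)%N -> \sum_(x <- s) x ^+ r \in S) ->
  forall k, (k <= h)%N -> (rev_roots_poly s)`_k \in S.
Proof.
move=> /pcharf0P nat0 pS k; have [n] := ubnP k; elim: n k => // n IHn [_ _|k].
  rewrite -horner_coef0 horner_prod big1 ?rpred1 // => x _.
  by rewrite !hornerE ?mulr0 ?subr0.
rewrite ltnS => lt_kn lt_kh.
have := newton_identity s k; rewrite -mulr_natr => /(congr1 -%R); rewrite opprK => kE.
have k0 : k.+1%:R != 0 :> F by rewrite nat0.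
rewrite -[_`_k.+1](mulfK k0) -kE rpred_div ?rpred_nat // rpredN rpred_sum // => i _.
rewrite rpredM // ?pS //=.
  by rewrite (leq_trans _ lt_kh) // ltn_ord.
by apply: IHn; rewrite ?(leq_ltn_trans (leq_subr _ _)) //
  (leq_trans (leq_subr _ _)) // ltnW.
Qed.

Lemma coef_rev_roots_poly (s : seq F) k : (k <= size s)%N ->
  (rev_roots_poly s)`_k = (\prod_(x <- s) ('X - x%:P))`_(size s - k).
Proof.
rewrite /rev_roots_poly; elim: s k => [|x s IHs] k /=.
  by rewrite leqn0 => /eqP->; rewrite !big_nil.
have size_E : (size (\prod_(y <- s) (1 - y%:P * 'X))%R <= (size s).+1)%N.
  elim: s {IHs} => [|y s IHs]; first by rewrite big_nil size_poly1.
  rewrite big_cons mulrBl mul1r -mulrA; apply: leq_trans (size_polyD _ _) _.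
  rewrite size_polyN geq_max (leq_trans IHs) //= mul_polyC.
  apply: leq_trans (size_scale_leq _ _) _; rewrite mulrC.
  by apply: leq_trans (size_polyMleq _ _) _; rewrite size_polyX addn2.
rewrite !big_cons mulrBl mul1r mulrBl !coefB coefXM coefCM -mulrA coefCM coefXM.
case: k => [_|k lt_ks].
  rewrite IHs //= subn0 mulr0 subr0 subn0.
  by rewrite [X in _ - _ * X]nth_default ?mulr0 ?subr0 // size_prod_XsubC.
rewrite subSS /= (IHs k) //.
have [le_sk|lt_ks'] := leqP (size s) k.
  have -> : k = size s by apply/eqP; rewrite eqn_leq le_sk andbT.
  by rewrite subnn /= nth_default.
by rewrite IHs // subn_eq0 leqNgt lt_ks' /= subnS.
Qed.

(** Since X - x = -x (1 - x^-1 X), inverting the roots reverses the polynomial. *)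
Lemma reciprocal_prod_XsubC (s : seq F) : 0 \notin s -> perm_eq [seq x^-1 | x <- s] s ->
    \prod_(x <- s) x = 1 ->
  \prod_(x <- s) ('X - x%:P) = (-1) ^+ size s *: rev_roots_poly s.
Proof.
move=> s0 sV s1; rewrite /rev_roots_poly -[in RHS](perm_big _ sV) /= big_map.
transitivity (\prod_(x <- s) ((- x)%:P * (1 - x^-1%:P * 'X))).
  apply: eq_big_seq => x xs.
  have x0 : x != 0 by apply: contraNneq s0 => <-.
  by rewrite mulrBr mulr1 mulrA -polyCM mulNr divff // !polyCN mulN1r opprK addrC.
rewrite big_split /= -mul_polyC; congr (_ * _).
rewrite -rmorph_prod /=; congr (_%:P).
transitivity ((-1) ^+ size s * \prod_(x <- s) x); last by rewrite s1 mulr1.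
elim: s {s0 sV s1} => [|x s IHs]; first by rewrite !big_nil mulr1.
by rewrite !big_cons IHs exprS mulrACA mulN1r.
Qed.

(** Newton's identities reach the coefficients of index at most h; the others
mirror them, because the polynomial is its own reversal up to sign. *)
Lemma reciprocal_polyOver (s : seq F) h : [pchar F] =i pred0 ->
    0 \notin s -> perm_eq [seq x^-1 | x <- s] s -> \prod_(x <- s) x = 1 ->
    (size s <= h.*2)%N ->
    (forall r, (0 < r <= h)%N -> \sum_(x <- s) x ^+ r \in S) ->
  \prod_(x <- s) ('X - x%:P) \is a polyOver S.
Proof.
move=> char0 s0 sV s1 le_sh pS.
have sE := reciprocal_prod_XsubC s0 sV s1.
have ES := rev_roots_poly_mem char0 pS.
apply/polyOverP => k; have [le_kh|lt_hk] := leqP k h.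
  by rewrite sE coefZ rpredM ?rpredX ?rpredN1 // ES.
have [le_ks|lt_sk] := leqP k (size s); last first.
  by rewrite nth_default ?rpred0 // size_prod_XsubC.
rewrite -[k](subKn le_ks) -coef_rev_roots_poly ?leq_subr // ES //.
by rewrite leq_subLR (leq_trans le_sh) // -addnn leq_add2r ltnW.
Qed.

End PowerSums.

(** * Ratios of variables and the root system A_(n-1) *)

(** Rooks that pairwise attack each other stand on a common row or on a common
column. *)
Lemma rook_clique (T : finType) (U V : eqType) (D : {pred T}) (a : T -> U) (b : T -> V) :
    {in D &, forall j l, j != l -> (a j == a l) (+) (b j == b l)} ->
  {in D &, forall j l, a j = a l} \/ {in D &, forall j l, b j = b l}.
Proof.
move=> ab; have [/forall_inP aE|] := boolP [forall j in D, [forall l in D, a j == a l]].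
  by left=> j l Dj Dl; apply/eqP; have /forall_inP := aE j Dj; apply.
case/forall_inPn => j Dj /forall_inPn[l Dl ne_a]; right.
suff bE p : p \in D -> b p = b j by move=> p q Dp Dq; rewrite !bE.
move=> Dp; apply/eqP; apply: contraNT ne_a => ne_b.
have ne_pj : p != j by apply: contraNneq ne_b => ->.
have apj : a p = a j.
  by have := ab _ _ Dp Dj ne_pj; rewrite (negPf ne_b) addbF => /eqP.
have [-> //|ne_jl] := eqVneq j l; have [<-|ne_pl] := eqVneq p l; first by rewrite apj.
have := ab _ _ Dp Dl ne_pl; rewrite apj.
case: (b p =P b l) => [bpl|_]; last by rewrite addbF.
have := ab _ _ Dj Dl ne_jl.
by rewrite -bpl eq_sym [b j == _]eq_sym (negPf ne_b) addbF eq_sym.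
Qed.

Section Ratios.
Variables (k : fieldType) (m n : nat).
Local Notation F := (ratfun k m n).
Local Notation rvar := (@rvar k m n).

Definition xratio (i : 'I_m) (j l : 'I_n) : F := rvar i j / rvar i l.

Lemma xratio_neq0 i j l : xratio i j l != 0.
Proof. by rewrite mulf_neq0 ?invr_eq0 ?rvar_neq0. Qed.

Lemma xratioM i j l p : xratio i j l * xratio i l p = xratio i j p.
Proof. by rewrite /xratio mulrA divfK ?rvar_neq0. Qed.

Lemma xratioV i j l : (xratio i j l)^-1 = xratio i l j.
Proof. by rewrite /xratio invf_div. Qed.

Lemma xratioxx i j : xratio i j j = 1.
Proof. by rewrite /xratio divff ?rvar_neq0. Qed.

Lemma mxvec_index_eq (i i' : 'I_m) (j j' : 'I_n) :
  (mxvec_index i j == mxvec_index i' j') = (i == i') && (j == j').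
Proof.
rewrite -xpair_eqE; apply/eqP/eqP => [E|[-> ->] //].
by case: (curry_mxvec_bij m n) => g gK _; rewrite -[LHS]gK // -[RHS]gK //= E.
Qed.

Lemma rmon_inj : injective (fun a : 'X_{1..m * n} => rpoly 'X_[a] : F).
Proof.
move=> a b /rpoly_inj /(congr1 (mcoeff a)).
rewrite !mcoeffX eqxx; case: eqP => // _ /eqP.
by rewrite oner_eq0.
Qed.

Lemma xratio_inj i i' j l j' l' : j != l -> xratio i j l = xratio i' j' l' ->
  [/\ i = i', j = j' & l = l'].
Proof.
move=> jl /eqP; rewrite eqr_div ?rvar_neq0 // -!rmorphM -!mpolyXD => /eqP/rmon_inj.
move/mnmP => E.
have Ev u v : (((i, j) == (u, v)) + ((i', l') == (u, v)) =
               ((i', j') == (u, v)) + ((i, l) == (u, v)))%N.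
  by have := E (mxvec_index u v); rewrite !mnmDE !mnm1E !mxvec_index_eq !xpair_eqE.
have := Ev i j; have := Ev i l; rewrite !eqxx xpair_eqE (negPf jl) andbF.
rewrite [(i, l) == _]xpair_eqE [l == j]eq_sym (negPf jl) andbF addn0 addn1.
case: eqP => [[_ ->] _|_]; last by case: eqP.
by case: ((i', j') =P (i, j)) => [[-> ->]|_]; last by case: eqP.
Qed.

Lemma xratio_eq1 i j l : (xratio i j l == 1) = (j == l).
Proof.
apply/eqP/eqP => [|->]; last exact: xratioxx.
rewrite -(xratioxx i l); have [//|ne] := eqVneq j l.
by case/(xratio_inj ne) => _ ->.
Qed.

(** A difference of two roots e_a - e_b and e_c - e_d of A_(n-1) is a root only if
they share their positive part or their negative part, but not both. *)
Lemma xratio_div_xratio i a b c d e f : a != b -> c != d -> e != f ->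
  xratio i a b / xratio i c d = xratio i e f -> (a == c) (+) (b == d).
Proof.
move=> ab cd ef E.
have ac_bd : ~~ ((a == c) && (b == d)).
  apply: contraNN ef => /andP[/eqP ac /eqP bd].
  by rewrite -(xratio_eq1 i) -E ac bd divff ?xratio_neq0.
suff : (a == c) || (b == d) by case: (a == c) ac_bd; case: (b == d).
move/eqP: E; rewrite xratioV mulf_div eqr_div ?mulf_neq0 ?rvar_neq0 //.
rewrite -!rmorphM -!mpolyXD => /eqP/rmon_inj/mnmP => E.
have Ev v : ((a == v) + (d == v) + (f == v) = (e == v) + ((b == v) + (c == v)))%N.
  by have := E (mxvec_index i v); rewrite !mnmDE !mnm1E !mxvec_index_eq !eqxx.
apply/norP => -[/negPf ac /negPf bd].
have := Ev a; rewrite eqxx [b == a]eq_sym (negPf ab) [c == a]eq_sym ac addn0.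
case: (e =P a) => [ea|]; last by [].
case: (d =P a) => [da|_ _]; first by [].
have := Ev d; rewrite eqxx bd (negPf cd) addn0.
have [ed|] := eqVneq e d; last by rewrite addnAC addn1.
by have := Ev a; rewrite eqxx [b == a]eq_sym (negPf ab) [c == a]eq_sym ac -ea ed eqxx.
Qed.

(** The values sigma j j0, for j <> j0, are roots whose pairwise differences are
roots. By [rook_clique] they share their denominator, or they share their
numerator; the other parts then give a permutation of the indices, which
maps j0 to the shared one. *)
Lemma root_cocycle (i : 'I_m) (j0 : 'I_n) (sigma : 'I_n -> 'I_n -> F) :
    (forall j, sigma j j = 1) ->
    (forall j l p, sigma j l * sigma l p = sigma j p) ->
    (forall j l, j != l -> exists a b, a != b /\ sigma j l = xratio i a b) ->
  exists (s : 'S_n) (e : bool), forall j l,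
    sigma j l = if e then xratio i (s l) (s j) else xratio i (s j) (s l).
Proof.
move=> s1 sM sR.
have sV j l : sigma j l = (sigma l j)^-1.
  by apply/esym/mulr1_eq; rewrite sM s1.
have /fin_all_exists[ab abP] j : exists ab : 'I_n * 'I_n, j != j0 ->
    ab.1 != ab.2 /\ sigma j j0 = xratio i ab.1 ab.2.
  have [->|/sR[a [b abP]]] := eqVneq j j0; first by exists (j0, j0).
  by exists (a, b).
pose D := predC1 j0.
have clique : {in D &, forall j l, j != l ->
    ((ab j).1 == (ab l).1) (+) ((ab j).2 == (ab l).2)}.
  move=> j l /abP[jab jE] /abP[lab lE] ne_jl.
  have [c [d [cd cdE]]] := sR j l ne_jl.
  apply: (xratio_div_xratio (i := i) jab lab cd); rewrite -jE -lE -cdE.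
  by rewrite -[sigma l j0]invrK -sV invrK sM.
(* The permutation sends j0 to the shared index c and j to the other part of
   sigma j j0. *)
have extend (c : 'I_n) (b : 'I_n -> 'I_n) : {in D, forall j, b j != c} ->
    {in D &, injective b} -> injective (fun j => if j == j0 then c else b j).
  move=> bc bI j l; case: eqVneq => [->|jD]; case: eqVneq => [->|lD] //.
  - by move/esym/eqP; rewrite (negPf (bc l lD)).
  - by move/eqP; rewrite (negPf (bc j jD)).
  - exact: bI.
have [j1 j1D|D0] := pickP D; last first.
  exists 1%g, false => j l; have j0E p : p = j0 by apply/eqP/negPn/negbT/D0.
  by rewrite (j0E j) (j0E l) s1 xratioxx.
have [aE|bE] := rook_clique clique.
- have bI : {in D &, injective (fun j => (ab j).2)}.
    move=> j l Dj Dl /= bjl; apply/eqP/negPn/negP => ne_jl.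
    by have := clique j l Dj Dl ne_jl; rewrite bjl (aE j l) // !eqxx.
  have bc : {in D, forall j, (ab j).2 != (ab j1).1}.
    by move=> j Dj; have [ne _] := abP j Dj; rewrite (aE j1 j) // eq_sym.
  exists (perm (extend _ _ bc bI)), true => j l.
  have sE p : sigma p j0 =
      xratio i (perm (extend _ _ bc bI) j0) (perm (extend _ _ bc bI) p).
    rewrite !permE eqxx; have [->|Dp] := eqVneq p j0; first by rewrite s1 xratioxx.
    by have [_ ->] := abP p Dp; rewrite (aE p j1).
  by rewrite -(sM j j0 l) [sigma j0 l]sV !sE xratioV mulrC xratioM.
- have aI : {in D &, injective (fun j => (ab j).1)}.
    move=> j l Dj Dl /= ajl; apply/eqP/negPn/negP => ne_jl.
    by have := clique j l Dj Dl ne_jl; rewrite ajl (bE j l) // !eqxx.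
  have ac : {in D, forall j, (ab j).1 != (ab j1).2}.
    by move=> j Dj; have [ne _] := abP j Dj; rewrite (bE j1 j).
  exists (perm (extend _ _ ac aI)), false => j l.
  have sE p : sigma p j0 =
      xratio i (perm (extend _ _ ac aI) p) (perm (extend _ _ ac aI) j0).
    rewrite !permE eqxx; have [->|Dp] := eqVneq p j0; first by rewrite s1 xratioxx.
    by have [_ ->] := abP p Dp; rewrite (bE p j1).
  by rewrite -(sM j j0 l) [sigma j0 l]sV !sE xratioV xratioM.
Qed.

Section ProductMonomials.
Implicit Types a b : 'I_m -> 'I_n.

(** Exponents of the product of the ratios x_(i,a i) / x_(i,b i), multiplied by
all the variables in order to clear denominators. *)
Definition ratio_prod_mnm a b : 'X_{1..m * n} :=
  [multinom mxvec (\matrix_(i, j) (1 + (j == a i) - (j == b i))%N) ord0 c | c < m * n].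

Lemma ratio_prod_mnmE a b i j :
  ratio_prod_mnm a b (mxvec_index i j) = (1 + (j == a i) - (j == b i))%N.
Proof. by rewrite mnmE mxvecE mxE. Qed.

Lemma prod_ratio_mnm a b :
  (\prod_i xratio i (a i) (b i)) * \prod_i \prod_j rvar i j
    = rpoly 'X_[ratio_prod_mnm a b].
Proof.
rewrite rpoly_mnm -big_split; apply: eq_bigr => i _ /=.
under [RHS]eq_bigr => j _ do rewrite ratio_prod_mnmE.
have [abi|ne_ab] := eqVneq (a i) (b i).
  rewrite abi xratioxx mul1r; apply: eq_bigr => j _.
  by rewrite addnK expr1.
rewrite (bigD1 (a i)) //= [in RHS](bigD1 (a i)) //= eqxx (negPf ne_ab).
rewrite (bigD1 (b i)) 1?eq_sym //= [in RHS](bigD1 (b i)) 1?eq_sym //=.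
rewrite !eqxx (negPf ne_ab) /= addn0 subnn expr0 mul1r.
rewrite [X in _ = _ * X](eq_bigr (rvar i)) => [|j /andP[/negPf-> /negPf->] //].
rewrite /xratio subn0 expr2; set P := \prod_(_ < _ | _) _.
by rewrite mulrACA mulKf ?rvar_neq0.
Qed.

Lemma ratio_prod_mnm_inj a b a' b' : (forall i, a i != b i) ->
  ratio_prod_mnm a b = ratio_prod_mnm a' b' -> a =1 a' /\ b =1 b'.
Proof.
move=> ab /mnmP E; split=> i.
  have := E (mxvec_index i (a i)); rewrite !ratio_prod_mnmE eqxx (negPf (ab i)).
  by case: (a i =P a' i); case: (a i =P b' i).
have := E (mxvec_index i (b i)); rewrite !ratio_prod_mnmE eqxx eq_sym (negPf (ab i)).
by case: (b i =P b' i); case: (b i =P a' i).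
Qed.

(** The terms of both sides are monomials with coefficient 1, so that in characteristic 0
none of them cancels, and one that occurs on the left occurs on the right. *)
Lemma eq_sum_prod_ratio (T : finType) (a b a' b' : T -> 'I_m -> 'I_n) :
    [pchar k] =i pred0 ->
    \sum_t \prod_i xratio i (a t i) (b t i) = \sum_t \prod_i xratio i (a' t i) (b' t i) ->
  forall t, (forall i, a t i != b t i) -> exists u, a t =1 a' u /\ b t =1 b' u.
Proof.
move=> char0 E t ab.
have rpE (c d : T -> 'I_m -> 'I_n) :
    (\sum_t \prod_i xratio i (c t i) (d t i)) * \prod_i \prod_j rvar i j =
    rpoly (\sum_t 'X_[ratio_prod_mnm (c t) (d t)]).
  by rewrite raddf_sum mulr_suml; apply: eq_bigr => u _; apply: prod_ratio_mnm.
have := rpE a b; rewrite E rpE => /rpoly_inj.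
move/(congr1 (mcoeff (ratio_prod_mnm (a t) (b t)))).
rewrite !raddf_sum /=; under eq_bigr do rewrite mcoeffX.
under [RHS]eq_bigr do rewrite mcoeffX.
rewrite -!natr_sum => /eqP.
have [u /eqP/esym/ratio_prod_mnm_inj-/(_ ab) uE _|none] :=
    pickP (fun u => ratio_prod_mnm (a' u) (b' u) == ratio_prod_mnm (a t) (b t)).
  by exists u.
rewrite big1 => [|u _]; last by rewrite none.
by rewrite eq_sym (proj1 (pcharf0P _) char0) (bigD1 t) //= eqxx.
Qed.

End ProductMonomials.

End Ratios.
Arguments xratio {k m n} i j l.

(** * Invariance and homogeneity of the generated field *)

Section Action.
Variables (k : fieldType) (m n : nat).
Local Notation F := (ratfun k m n).
Local Notation rvar := (@rvar k m n).

Definition Gaut (g : 'S_n * 'Z_2) (f : F) : F := Gact k m n f g.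

Fact Gaut_is_zmod_morphism g : zmod_morphism (Gaut g).
Proof.
move=> f h; rewrite /Gaut /= /Gact_fun /=.
by elim: (nat_of_ord _) => [|e IHe] /=; rewrite ?IHe rmorphB.
Qed.
Fact Gaut_is_monoid_morphism g : monoid_morphism (Gaut g).
Proof.
split=> [|f h]; rewrite /Gaut /= /Gact_fun /=;
  by elim: (nat_of_ord _) => [|e IHe] /=; rewrite ?IHe ?rmorph1 ?rmorphM.
Qed.
HB.instance Definition _ g := GRing.isZmodMorphism.Build F F (Gaut g)
  (Gaut_is_zmod_morphism g).
HB.instance Definition _ g := GRing.isMonoidMorphism.Build F F (Gaut g)
  (Gaut_is_monoid_morphism g).

Lemma Gaut_cst g (c : k) : Gaut g (rcst _ _ c) = rcst _ _ c.
Proof.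
rewrite /Gaut /= /Gact_fun symact_cst.
by elim: (nat_of_ord _) => //= e ->; rewrite tau_cst.
Qed.

Lemma Gaut_ratio (s : 'S_n) (e : bool) i j l :
  Gaut (s, e%:R) (xratio i j l) =
    if e then xratio i (s l) (s j) else xratio i (s j) (s l).
Proof.
rewrite /Gaut /= /Gact_fun /= /xratio fmorph_div /= !symact_var.
by case: e => //=; rewrite fmorph_div /= !tau_var invrK mulrC.
Qed.

Lemma Gaut_bool (g : 'S_n * 'Z_2) : exists (s : 'S_n) (e : bool), g = (s, e%:R).
Proof.
case: g => s [[|[|//]] lt]; exists s; [exists false | exists true];
  by congr (_, _); apply: val_inj.
Qed.

Lemma qonesE : qones = \sum_(t : 'I_n * 'I_n) \prod_i xratio i t.1 t.2 :> F.
Proof.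
rewrite /qones /ttr mulr_suml -(pair_bigA _ (fun j l => \prod_i xratio i j l)) /=.
apply: eq_bigr => j _; rewrite mulr_sumr; apply: eq_bigr => l _.
by rewrite -prodfV -big_split.
Qed.

Lemma qpowE i r : qpow i r = \sum_(t : 'I_n * 'I_n) xratio i t.1 t.2 ^+ r :> F.
Proof.
rewrite /qpow /ttr mulr_suml -(pair_bigA _ (fun j l => xratio i j l ^+ r)) /=.
apply: eq_bigr => j _; rewrite mulr_sumr; apply: eq_bigr => l _.
by rewrite -exprVn -exprMn.
Qed.

(** Each element of G permutes the ordered pairs of indices, tau exchanging the two
members of a pair. *)
Lemma Gaut_pair_sum (g : 'S_n * 'Z_2) (Q : 'I_n * 'I_n -> F) :
    (forall s e j l, g = (s, (e : bool)%:R) ->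
       Gaut g (Q (j, l)) = if e then Q (s l, s j) else Q (s j, s l)) ->
  Gaut g (\sum_t Q t) = \sum_t Q t.
Proof.
move=> QG; have [s [e gE]] := Gaut_bool g.
rewrite raddf_sum.
pose h (t : 'I_n * 'I_n) := if e then (s t.2, s t.1) else (s t.1, s t.2).
have h_inj : injective h.
  by move=> [j l] [j' l'] /=; rewrite /h; case: e {gE h} => -[/perm_inj-> /perm_inj->].
rewrite [RHS](reindex_inj h_inj); apply: eq_bigr => -[j l] _.
by rewrite /= (QG s e) // /h; case: e {h h_inj gE}.
Qed.

Lemma Gaut_gens g (f : F) : gens f -> Gaut g f = f.
Proof.
case=> [->|[i [r [_ ->]]]].
  rewrite qonesE; apply: (Gaut_pair_sum) => s e j l -> /=.
  by rewrite rmorph_prod; under eq_bigr => i _ do rewrite /= Gaut_ratio; case: e.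
rewrite qpowE; apply: (Gaut_pair_sum) => s e j l -> /=.
by rewrite rmorphXn /= Gaut_ratio; case: e.
Qed.

Lemma Gaut_genfield g (f : F) : genfield gens f -> Gaut g f = f.
Proof.
elim=> {f} [c|f /Gaut_gens//|f h _ fE _ hE|f _ fE|f h _ fE _ hE|f _ fE].
- exact: Gaut_cst.
- by rewrite rmorphD /= fE hE.
- by rewrite rmorphN /= fE.
- by rewrite rmorphM /= fE hE.
- by rewrite fmorphV /= fE.
Qed.

Lemma homog0_cst (c : k) : homog0 (rcst m n c).
Proof.
exists c%:MP, 1, (fun=> 0%N); split; rewrite ?oner_neq0 ?rmorph1 ?divr1 //.
by move=> i; rewrite dhomog1 -alg_mpolyC rpredZ ?dhomog1.
Qed.

Lemma homog0D (f g : F) : homog0 f -> homog0 g -> homog0 (f + g).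
Proof.
move=> [p [q [d [q0 -> pq]]]] [p' [q' [d' [q0' -> pq']]]].
exists (p * q' + p' * q), (q * q'), (fun i => d i + d' i)%N; split.
- exact: mulf_neq0.
- by rewrite addf_div ?rpoly_eq0 // rmorphD !rmorphM.
- move=> i; have [[hp hq] [hp' hq']] := (pq i, pq' i).
  split; last exact: dhomogM.
  by apply: rpredD; [|rewrite addnC]; apply: dhomogM.
Qed.

Lemma homog0N (f : F) : homog0 f -> homog0 (- f).
Proof.
move=> [p [q [d [q0 -> pq]]]]; exists (- p), q, d; rewrite rmorphN mulNr.
by split=> // i; have [hp hq] := pq i; rewrite rpredN.
Qed.

Lemma homog0M (f g : F) : homog0 f -> homog0 g -> homog0 (f * g).
Proof.
move=> [p [q [d [q0 -> pq]]]] [p' [q' [d' [q0' -> pq']]]].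
exists (p * p'), (q * q'), (fun i => d i + d' i)%N; split.
- exact: mulf_neq0.
- by rewrite mulf_div !rmorphM.
- move=> i; have [[hp hq] [hp' hq']] := (pq i, pq' i).
  by rewrite !dhomogM.
Qed.

Lemma homog0V (f : F) : homog0 f -> homog0 f^-1.
Proof.
move=> [p [q [d [q0 -> pq]]]]; have [->|p0] := eqVneq p 0.
  by rewrite rmorph0 mul0r invr0 -(rmorph0 (rcst m n)); apply: homog0_cst.
exists q, p, d; rewrite invf_div; split=> // i.
by have [hp hq] := pq i.
Qed.

Lemma homog0_ratio i j l : homog0 (xratio i j l : F).
Proof.
exists 'X_(mxvec_index i j), 'X_(mxvec_index i l), (fun i' => (i == i') : nat).
split=> //.
  by rewrite -(rpoly_eq0 (m := m)) rvar_neq0.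
have adegX i' j' : adeg i' U_(mxvec_index i j')%MM = (i == i').
  rewrite /adeg; under eq_bigr do rewrite mnm1E mxvec_index_eq.
  have [_|ne] := eqVneq i i'; last by rewrite big1.
  by rewrite (bigD1 j') //= eqxx big1 // => j'' /negPf; rewrite eq_sym => ->.
by move=> i'; rewrite !dhomogX; split; apply/eqP; apply: adegX.
Qed.

Lemma homog0_sum (I : Type) (r : seq I) (E : I -> F) :
  (forall i, homog0 (E i)) -> homog0 (\sum_(i <- r) E i).
Proof.
move=> hE; elim/big_ind: _ => // [|f g]; last exact: homog0D.
by rewrite -(rmorph0 (rcst m n)); apply: homog0_cst.
Qed.

Lemma homog0_prod (I : Type) (r : seq I) (E : I -> F) :
  (forall i, homog0 (E i)) -> homog0 (\prod_(i <- r) E i).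
Proof.
move=> hE; elim/big_ind: _ => // [|f g]; last exact: homog0M.
by rewrite -(rmorph1 (rcst m n)); apply: homog0_cst.
Qed.

Lemma homog0_genfield (f : F) : genfield gens f -> homog0 f.
Proof.
elim=> {f} [c|f|f h _ hf _ hh|f _|f h _ hf _ hh|f _].
- exact: homog0_cst.
- case=> [->|[i [r [_ ->]]]].
    rewrite qonesE; apply: homog0_sum => t; apply: homog0_prod => i.
    exact: homog0_ratio.
  rewrite qpowE; apply: homog0_sum => t; rewrite -[r]card_ord -prodr_const.
  by apply: homog0_prod => _; apply: homog0_ratio.
- exact: homog0D.
- exact: homog0N.
- exact: homog0M.
- exact: homog0V.
Qed.

(** Dividing by x_(i,j0)^(d i) dehomogenizes p in the array X_i. *)
Lemma psubst_ratio (j0 : 'I_n) (d : 'I_m -> nat) (p : {mpoly k[m * n]}) :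
    (forall i, p \is ishomog1 (d i) (adeg i)) ->
  psubst (\matrix_(i, j) xratio i j j0) p * \prod_i rvar i j0 ^+ d i = rpoly p.
Proof.
move=> hp; rewrite psubst_sum [p in RHS]mpolyE raddf_sum mulr_suml /=.
rewrite big_seq [RHS]big_seq; apply: eq_bigr => a a_p.
rewrite -mul_mpolyC rmorphM -mulrA /=; congr (_ * _).
rewrite rpoly_mnm -big_split; apply: eq_bigr => i _ /=.
have <- : adeg i a = d i by move/dhomogP: (hp i) => /(_ a a_p).
rewrite /adeg -prodrXr -big_split; apply: eq_bigr => j _ /=.
by rewrite mxE -exprMn /xratio divfK ?rvar_neq0.
Qed.

Lemma homog0_psubst (j0 : 'I_n) (f : F) : homog0 f -> exists p q : {mpoly k[m * n]},
  let v := \matrix_(i, j) xratio i j j0 in psubst v q != 0 /\ f = psubst v p / psubst v q.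
Proof.
case=> p [q [d [q0 -> pq]]]; exists p, q => v.
have x0 : \prod_i rvar i j0 ^+ d i != 0.
  by apply/prodf_neq0 => i _; rewrite expf_neq0 ?rvar_neq0.
have pE := psubst_ratio j0 (fun i => proj1 (pq i)).
have qE := psubst_ratio j0 (fun i => proj2 (pq i)).
split.
  apply: contraNneq q0 => v0.
  by rewrite -(rpoly_eq0 (m := m)) -qE -/v v0 mul0r.
by rewrite -pE -qE -mulf_div divff // mulr1.
Qed.

End Action.

(** * A subfield as a field type *)

Section Subfield.
Variables (F : fieldType) (S : divringClosed F).

Inductive subfield_of := SubfieldOf x & x \in S.
Definition subfield_val u := let: SubfieldOf x _ := u in x.
HB.instance Definition _ := [isSub for subfield_val].
HB.instance Definition _ := [Choice of subfield_of by <:].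
HB.instance Definition _ := [SubChoice_isSubUnitRing of subfield_of by <:].
HB.instance Definition _ := [SubNzRing_isSubComNzRing of subfield_of by <:].
HB.instance Definition _ := [SubComUnitRing_isSubIntegralDomain of subfield_of by <:].
HB.instance Definition _ := [SubIntegralDomain_isSubField of subfield_of by <:].

(** A name for the inclusion that simplification leaves in place, so that it keeps
its morphism structure. *)
Definition subfield_emb : subfield_of -> F := val.
HB.instance Definition _ := GRing.RMorphism.copy subfield_emb val.

Lemma polyOver_subfield p : p \is a polyOver S ->
  exists q : {poly subfield_of}, map_poly subfield_emb q = p.
Proof.
move=> /polyOverP pS; exists (\poly_(i < size p) Sub p`_i (pS i)).
apply/polyP => i; rewrite coef_map coef_poly; case: ltnP => [_|le]; first exact: SubK.
by rewrite [RHS]nth_default //; apply: rmorph0.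
Qed.

End Subfield.

(** * The field generated by the trace products *)

Lemma horner_prod_XsubC_eq0 (K : fieldType) (T : finType) (D : pred T) (f : T -> K) x :
  (\prod_(t | D t) ('X - (f t)%:P)).[x] = 0 <-> exists2 t, D t & x = f t.
Proof.
split=> [/eqP|[t Dt ->]].
  rewrite horner_prod => /prodf_eq0[t Dt].
  by rewrite hornerXsubC subr_eq0 => /eqP; exists t.
by rewrite horner_prod (bigD1 t) //= hornerXsubC subrr mul0r.
Qed.

Section Generated.
Variables (k : fieldType) (m n : nat).
Local Notation F := (ratfun k m n).

(** Membership is decided classically, because closed subsets of a ring are boolean
predicates. *)
Definition gens_field : {pred F} :=
  fun f => if excluded_middle_informative (genfield gens f) then true else false.

Lemma gens_fieldP f : reflect (genfield gens f) (f \in gens_field).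
Proof.
by rewrite unfold_in /gens_field; case: excluded_middle_informative => H; constructor.
Qed.

Fact gens_field_divring_closed : divring_closed gens_field.
Proof.
split=> [|f g /gens_fieldP hf /gens_fieldP hg|f g /gens_fieldP hf /gens_fieldP hg];
  apply/gens_fieldP.
- by rewrite -(rmorph1 (rcst m n)); apply: gen_cst.
- by apply: gen_add => //; apply: gen_opp.
- by apply: gen_mul => //; apply: gen_inv.
Qed.
HB.instance Definition _ := GRing.isDivringClosed.Build F gens_field
  gens_field_divring_closed.

Lemma ratfun_pchar0 : [pchar k] =i pred0 -> [pchar F] =i pred0.
Proof.
move=> k0 p; rewrite -(k0 p) !inE -(rmorph_nat (rcst m n)).
by rewrite fmorph_eq0.
Qed.

(** The n(n-1) ratios x_ij / x_il with j <> l are stable under inversion, their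
product is 1, and the sum of their r-th powers is qpow i r minus the n diagonal
terms. *)
Lemma block_polyOver i : [pchar k] =i pred0 ->
  \prod_(t : 'I_n * 'I_n | t.1 != t.2) ('X - (xratio i t.1 t.2 : F)%:P)
    \is a polyOver gens_field.
Proof.
move=> char0; pose s : seq F :=
  [seq xratio i t.1 t.2 | t <- enum [pred t : 'I_n * 'I_n | t.1 != t.2]].
have bigE (R : Type) (idx : R) (op : Monoid.com_law idx) (G : F -> R) :
    \big[op/idx]_(x <- s) G x =
    \big[op/idx]_(t : 'I_n * 'I_n | t.1 != t.2) G (xratio i t.1 t.2).
  by rewrite big_map big_enum.
rewrite -(bigE _ _ _ (fun x => 'X - x%:P)).
have swap_inj : injective (fun t : 'I_n * 'I_n => (t.2, t.1)).
  by move=> [? ?] [? ?] [-> ->].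
have diag : #|[pred t : 'I_n * 'I_n | t.1 == t.2]| = n.
  rewrite -[RHS]card_ord -(card_imset _ (f := fun j : 'I_n => (j, j))); last first.
    by move=> ? ? [].
  apply: eq_card => -[j l]; rewrite !inE /=; apply/eqP/imsetP => [->|[p _ [-> ->]] //].
  by exists l.
have offdiag : #|[pred t : 'I_n * 'I_n | t.1 != t.2]| = (n * (n - 1))%N.
  have := cardC [pred t : 'I_n * 'I_n | t.1 == t.2].
  by rewrite diag card_prod card_ord mulnBr muln1 => <-; rewrite addKn; apply: eq_card.
apply: (@reciprocal_polyOver _ _ _ ((n * (n - 1)) %/ 2)).
- exact: ratfun_pchar0.
- by apply/mapP => -[t _ /esym/eqP]; rewrite (negPf (xratio_neq0 _ _ _ _)).
- have -> : [seq x^-1 | x <- s] = [seq xratio i t.1 t.2 | t <- [seq (t.2, t.1) |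
      t <- enum [pred t : 'I_n * 'I_n | t.1 != t.2]]].
    by rewrite /s -!map_comp; apply: eq_map => t; apply: xratioV.
  rewrite perm_map // uniq_perm ?map_inj_uniq ?enum_uniq //.
  move=> [j l]; rewrite mem_enum -[(j, l)]/((fun t => (t.2, t.1)) (l, j)) mem_map //.
  by rewrite mem_enum !inE /= eq_sym.
- rewrite bigE /=.
  have -> : \prod_(t : 'I_n * 'I_n | t.1 != t.2) (xratio i t.1 t.2 : F) =
            \prod_(t : 'I_n * 'I_n) xratio i t.1 t.2.
    rewrite [RHS](bigID (fun t : 'I_n * 'I_n => t.1 != t.2)) /=.
    rewrite [X in _ = _ * X]big1 ?mulr1 // => t; rewrite negbK => /eqP->.
    exact: xratioxx.
  rewrite big_split /= prodfV [X in _ / X](reindex_inj swap_inj) /= divff //.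
  by apply/prodf_neq0 => t _; apply: rvar_neq0.
- rewrite size_map -cardE offdiag -muln2 divnK //.
  by rewrite dvdn2 subn1; case: (n) => // n' /=; rewrite oddM /= andNb.
- move=> r hr; rewrite (bigE _ _ _ (fun x => x ^+ r)).
  have -> : \sum_(t : 'I_n * 'I_n | t.1 != t.2) (xratio i t.1 t.2 : F) ^+ r =
      qpow i r - n%:R.
    rewrite qpowE [X in X - _](bigID (fun t : 'I_n * 'I_n => t.1 != t.2)) /=.
    rewrite [X in _ + X - _](eq_bigr (fun=> 1)); last first.
      by move=> t; rewrite negbK => /eqP->; rewrite xratioxx expr1n.
    rewrite sumr_const [X in _ + 1 *+ X - _](_ : _ = n) ?addrK //.
    by rewrite -[RHS]diag; apply: eq_card => t; rewrite !unfold_in /= negbK.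
  rewrite rpredB ?rpred_nat //; apply/gens_fieldP/gen_mem; right.
  by exists i, r.
Qed.

Definition root_index : predArgType := {t : 'I_m * ('I_n * 'I_n) | t.2.1 != t.2.2}.
Local Notation N := #|root_index|.
Local Notation L := (subfield_of gens_field).
Local Notation emb := (@subfield_emb F gens_field).

Definition root_val (a : 'I_N) : F :=
  let t := val (enum_val a) in xratio t.1 t.2.1 t.2.2.

Lemma root_val_inj : injective root_val.
Proof.
move=> a b /(xratio_inj (valP (enum_val a)))[E1 E2 E3].
apply/enum_val_inj/val_inj; move: E1 E2 E3.
case: (val (enum_val a)) => i [j l]; case: (val (enum_val b)) => i' [j' l'] /=.
by move=> -> -> ->.
Qed.

(** A polynomial in the roots with value x_ij / x_il, equal to 1 on the diagonal
j = l so that the cocycle relation holds for all indices without distinction. *)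
Definition ratio_mpoly (i : 'I_m) (j l : 'I_n) : {mpoly L[N]} :=
  oapp (fun t : root_index => 'X_(enum_rank t)) 1 (insub (i, (j, l))).

Lemma ratio_mpoly_offdiag (a : 'I_N) :
  let t := val (enum_val a) in ratio_mpoly t.1 t.2.1 t.2.2 = 'X_a.
Proof.
rewrite /ratio_mpoly; move: (valK (enum_val a)).
by case: (val (enum_val a)) => i [j l] /= ->; rewrite /= enum_valK.
Qed.

Lemma ratio_mpoly_diag i j : ratio_mpoly i j j = 1.
Proof. by rewrite /ratio_mpoly insubF //= eqxx. Qed.

Lemma ratio_mpoly_val i j l : mmap emb root_val (ratio_mpoly i j l) = xratio i j l.
Proof.
have [->|jl] := eqVneq j l; first by rewrite ratio_mpoly_diag rmorph1 xratioxx.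
have /= := ratio_mpoly_offdiag (enum_rank (Sub (i, (j, l)) jl : root_index)).
by rewrite enum_rankK /= => ->; rewrite mmapX mmap1U /root_val enum_rankK.
Qed.

Lemma root_val_polyOver : [pchar k] =i pred0 ->
  exists P : {poly L}, map_poly emb P = \prod_a ('X - (root_val a)%:P).
Proof.
move=> char0; apply: polyOver_subfield.
rewrite (reindex_onto enum_rank enum_val) => [|a _]; last exact: enum_valK.
under eq_bigl do rewrite enum_rankK eqxx.
under eq_bigr do rewrite /root_val enum_rankK.
pose G (t : 'I_m * ('I_n * 'I_n)) : {poly F} := 'X - (xratio t.1 t.2.1 t.2.2)%:P.
have -> : \prod_(t : root_index) G (val t) = \prod_(t | t.2.1 != t.2.2) G t.
  rewrite [RHS](reindex_omap (val : root_index -> _) insub) /=; last first.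
    by move=> t Dt; rewrite insubT.
  by apply: eq_bigl => t; rewrite valK eqxx (valP t).
rewrite -(pair_big xpredT (fun t : 'I_n * 'I_n => t.1 != t.2) (fun i t => G (i, t))) /=.
by apply: rpred_prod => i _; apply: block_polyOver.
Qed.

(** The transforms sigma i j l of the ratios by the permutation s satisfy the same
cocycle relations, are roots of the polynomial of their array, and have the
same sum of products; [root_cocycle] and [eq_sum_prod_ratio] turn these three
facts into a permutation of the indices and a sign common to all arrays. *)
Lemma root_val_conjugate (s : 'S_N) (i0 : 'I_m) (j0 : 'I_n) : [pchar k] =i pred0 ->
    (forall r : {mpoly L[N]}, mmap emb root_val r = 0 ->
       mmap emb (root_val \o s) r = 0) ->
  exists g, forall a, root_val (s a) = Gaut g (root_val a).
Proof.
move=> char0 rel.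
have relE (p q : {mpoly L[N]}) : mmap emb root_val p = mmap emb root_val q ->
    mmap emb (root_val \o s) p = mmap emb (root_val \o s) q.
  move=> /eqP; rewrite -subr_eq0 -rmorphB => /eqP/rel/eqP.
  by rewrite rmorphB subr_eq0 => /eqP.
pose sigma i j l := mmap emb (root_val \o s) (ratio_mpoly i j l).
have s1 i j : sigma i j j = 1 by rewrite /sigma ratio_mpoly_diag rmorph1.
have sM i j l p : sigma i j l * sigma i l p = sigma i j p.
  rewrite /sigma -rmorphM; apply: relE.
  by rewrite rmorphM /= !ratio_mpoly_val xratioM.
(* A conjugate of a root of the polynomial of the i-th array is another root. *)
have sR i j l : j != l -> exists a b, a != b /\ sigma i j l = xratio i a b.
  move=> jl; have [P PE] := polyOver_subfield (block_polyOver i char0).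
  have Phorner (v : 'I_N -> F) p :
      mmap emb v (map_poly (@mpolyC N L) P).[p] = (map_poly emb P).[mmap emb v p].
    rewrite -horner_map /= -map_poly_comp /=; congr (_.[_]).
    by apply: eq_map_poly => c /=; rewrite mmapC.
  have P0 : (map_poly emb P).[xratio i j l] = 0.
    by rewrite PE; apply/horner_prod_XsubC_eq0; exists (j, l).
  have := rel (map_poly (@mpolyC N L) P).[ratio_mpoly i j l].
  rewrite !Phorner ratio_mpoly_val P0 PE => /(_ erefl)/horner_prod_XsubC_eq0[[a b] ab sE].
  by exists a, b.
have /fin_all_exists[S /fin_all_exists[e SE]] i := root_cocycle j0 (s1 i) (sM i) (sR i).
pose A i (t : 'I_n * 'I_n) := if e i then S i t.2 else S i t.1.
pose B i (t : 'I_n * 'I_n) := if e i then S i t.1 else S i t.2.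
have ABE i j l : sigma i j l = xratio i (A i (j, l)) (B i (j, l)).
  by rewrite SE /A /B; case: (e i).
have qS : qones \in gens_field by apply/gens_fieldP/gen_mem; left.
have sum_eq : \sum_t \prod_i xratio i (A i t) (B i t) =
    \sum_(t : 'I_n * 'I_n) \prod_i xratio i t.1 t.2 :> F.
  have valE (v : 'I_N -> F) :
      mmap emb v (\sum_(t : 'I_n * 'I_n) \prod_i ratio_mpoly i t.1 t.2) =
      \sum_(t : 'I_n * 'I_n) \prod_i mmap emb v (ratio_mpoly i t.1 t.2).
    by rewrite raddf_sum; apply: eq_bigr => t _; apply: rmorph_prod.
  have := @relE (\sum_(t : 'I_n * 'I_n) \prod_i ratio_mpoly i t.1 t.2)
    (SubfieldOf qS)%:MP.
  rewrite !mmapC !valE => E; rewrite -qonesE; transitivity (emb (SubfieldOf qS)) => //; rewrite -E.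
    by apply: eq_bigr => -[j l] _; apply: eq_bigr => i _; rewrite -ABE.
  transitivity (qones : F) => //; rewrite qonesE.
  by apply: eq_bigr => t _; apply: eq_bigr => i _; apply: ratio_mpoly_val.
have same i t : t.1 != t.2 -> A i t = A i0 t /\ B i t = B i0 t.
  move=> ne_t; have [i'|u [Au Bu]] := @eq_sum_prod_ratio _ _ _ _ (fun t i => A i t)
    (fun t i => B i t) (fun t _ => t.1) (fun t _ => t.2) char0 sum_eq t.
    by rewrite /A /B; case: (e i'); rewrite (inj_eq perm_inj) // eq_sym.
  by rewrite !Au !Bu.
exists (S i0, (e i0)%:R) => a.
have := ratio_mpoly_offdiag a; have := valP (enum_val a); rewrite [in RHS]/root_val.
case: (val (enum_val a)) => i [j l] /= jl aE.
have -> : root_val (s a) = sigma i j l by rewrite /sigma aE mmapX mmap1U.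
have [AE BE] := same i (j, l) jl.
by rewrite ABE AE BE Gaut_ratio /A /B; case: (e i0).
Qed.

Lemma psubst_ratio_value (j0 : 'I_n) p : exists h : {mpoly L[N]},
  mmap emb root_val h = psubst (\matrix_(i, j) xratio i j j0) p.
Proof.
have cS c : rcst m n c \in gens_field by apply/gens_fieldP/gen_cst.
exists (\sum_(a <- msupp p) (SubfieldOf (cS p@_a))%:MP *
  \prod_i \prod_j ratio_mpoly i j j0 ^+ a (mxvec_index i j)).
rewrite psubst_sum raddf_sum; apply: eq_bigr => a _ /=.
rewrite rmorphM /= mmapC; congr (_ * _); rewrite rmorph_prod; apply: eq_bigr => i _.
rewrite rmorph_prod; apply: eq_bigr => j _.
by rewrite /= rmorphXn /= ratio_mpoly_val mxE.
Qed.

Lemma mmap_Gaut g (v w : 'I_N -> F) (h : {mpoly L[N]}) :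
  (forall a, w a = Gaut g (v a)) -> mmap emb w h = Gaut g (mmap emb v h).
Proof.
move=> wE; rewrite /mmap raddf_sum; apply: eq_bigr => a _ /=; rewrite rmorphM /=.
congr (_ * _).
  by symmetry; apply: Gaut_genfield; apply/gens_fieldP; apply: valP.
by rewrite /mmap1 rmorph_prod; apply: eq_bigr => i _; rewrite rmorphXn /= wE.
Qed.

Lemma invariant_genfield (i0 : 'I_m) (j0 : 'I_n) (f : F) : [pchar k] =i pred0 ->
  homog0 f -> (forall g, Gaut g f = f) -> genfield gens f.
Proof.
move=> char0 /(homog0_psubst j0)[p [q /= [q0 fE]]] fG.
have [h1 h1E] := psubst_ratio_value j0 p; have [h2 h2E] := psubst_ratio_value j0 q.
have [||||s|c] := @relation_descent L F emb N root_val h1 h2 f.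
- exact: ratfun_pchar0.
- exact: root_val_inj.
- exact: root_val_polyOver.
- by rewrite h2E.
- move=> /(root_val_conjugate i0 j0 char0)[g gE].
  have gval h := mmap_Gaut h (gE : forall a, (root_val \o s) a = _).
  by rewrite !gval -[in RHS](fG g) -rmorphM /= h1E h2E fE divfK.
- by move=> ->; apply/gens_fieldP; apply: valP.
Qed.

End Generated.

Theorem theorem5p1 (k : fieldType) (k_char0 : [pchar k] =i pred0)
    (m n : nat) (m_gt0 : (0 < m)%N) (n_gt0 : (0 < n)%N) (f : ratfun k m n) :
  (homog0 f /\ forall g : 'S_n * 'Z_2, Gact k m n f g = f) <->
  genfield gens f.
Proof.
split=> [[f0 fG]|fL].
  exact: (invariant_genfield (Ordinal m_gt0) (Ordinal n_gt0)).
by split=> [|g]; [apply: homog0_genfield | apply: Gaut_genfield].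
Qed.
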